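(* Let $\alpha>0$ be an absolute constant. Let $G_1=([m],[n],E_1)$ and $G_2=([m],[n],E_2)$ be two $(r,\Delta,\alpha\Delta)$-expanders. For each $i\in[m]$ let $C_i$ be a disjunction of literals, one for each variable in $\{x_j : j\in N_{G_1}(i)\}\cup\{y_j: j\in N_{G_2}(i)\}$, with arbitrary signs. Then there are constants $c_1,c_2>0$ depending only on $\alpha$ such that for every deterministic communication protocol $\Pi:\{0,1\}^n\times\{0,1\}^n\to[m]$ of depth $d\le c_1 \Delta r$, \[ \Pr_{(\bm x,\bm y)\sim\{0,1\}^n\times\{0,1\}^n}\big[C_{\Pi(\bm x,\bm y)}(\bm x,\bm y)=0\big]\le d\cdot 2^{-c_2\Delta}+e^{-d}. \]
   Context: A bipartite graph $G=(L,R,E)$ is an $(r,\Delta,\alpha\Delta)$-expander if every vertex in $L$ has degree at most $\Delta$ and every $S\subseteq L$ with $|S|\le r$ satisfies $|N_G(S)|\ge \alpha\Delta|S|$, where $N_G(S)$ is the neighbourhood of $S$. Alice holds $x\in\{0,1\}^n$, Bob holds $y\in\{0,1\}^n$, and $(\bm x,\bm y)$ is uniform. *)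

(* Defs.v *)
From mathcomp Require Import all_boot.
From Stdlib Require Import Reals.
Set Implicit Arguments. Unset Strict Implicit. Unset Printing Implicit Defensive.

Definition bits (n : nat) := {ffun 'I_n -> bool}.

Definition nbhd (m n : nat) (E : {set 'I_m * 'I_n}) (S : {set 'I_m}) : {set 'I_n} :=
  [set j | [exists i in S, (i, j) \in E]].

Definition is_expander (m n : nat) (E : {set 'I_m * 'I_n}) (r Delta : nat) (alpha : R) : Prop :=
  (forall i : 'I_m, #|nbhd E [set i]| <= Delta) /\
  (forall S : {set 'I_m}, #|S| <= r ->
     (alpha * INR Delta * INR #|S| <= INR #|nbhd E S|)%R).

(* Clause C_i: disjunction of one literal per variable x_j (j in N_{G1}(i)) and y_j
   (j in N_{G2}(i)); the literal on x_j is "x_j = s1 i j" (sign chosen by s1),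
   similarly for y_j. C_i(x,y) = 1 iff some literal is satisfied. *)
Definition clause_val (m n : nat) (E1 E2 : {set 'I_m * 'I_n})
  (s1 s2 : 'I_m -> 'I_n -> bool) (i : 'I_m) (x y : bits n) : bool :=
  [exists j in nbhd E1 [set i], x j == s1 i j] ||
  [exists j in nbhd E2 [set i], y j == s2 i j].

Inductive protocol (n m : nat) : Type :=
| PLeaf : 'I_m -> protocol n m
| PAlice : (bits n -> bool) -> protocol n m -> protocol n m -> protocol n m
| PBob : (bits n -> bool) -> protocol n m -> protocol n m -> protocol n m.

Fixpoint prot_eval (n m : nat) (P : protocol n m) (x y : bits n) : 'I_m :=
  match P with
  | PLeaf i => i
  | PAlice f P0 P1 => if f x then prot_eval P1 x y else prot_eval P0 x y
  | PBob g P0 P1 => if g y then prot_eval P1 x y else prot_eval P0 x y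
  end.

Fixpoint prot_depth (n m : nat) (P : protocol n m) : nat :=
  match P with
  | PLeaf _ => 0
  | PAlice _ P0 P1 => (maxn (prot_depth P0) (prot_depth P1)).+1
  | PBob _ P0 P1 => (maxn (prot_depth P0) (prot_depth P1)).+1
  end.

Definition fail_prob (m n : nat) (E1 E2 : {set 'I_m * 'I_n})
  (s1 s2 : 'I_m -> 'I_n -> bool) (P : protocol n m) : R :=
  (INR #|[set xy : bits n * bits n |
            ~~ clause_val E1 E2 s1 s2 (prot_eval P xy.1 xy.2) xy.1 xy.2]|
   / INR #|{: bits n * bits n}|)%R.

(* Main.v *)
Require Import Defs.
From mathcomp Require Import all_boot zify.
From Stdlib Require Import ZArith Reals Lra.
(* Reals rebinds [^] on nat to [Nat.pow]; this restores [expn]. *)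
From mathcomp Require Import ssrnat.
Set Implicit Arguments. Unset Strict Implicit. Unset Printing Implicit Defensive.

(** A node of the protocol carries a rectangle X * Y and a set D of discarded
    clauses; outside D, each clause is falsified on at most a 1/T fraction of X
    (for its x-part) and of Y (for its y-part).  When Alice's message shrinks X,
    some clauses may become heavy, i.e. falsified on more than a 1/T fraction of
    the new X.  As long as X has density at least 2^-3d, expansion and a union
    bound over k-subsets (k about d / Delta) show that the falsified fractions of
    the newly heavy clauses add up to at most k + 1.  Their y-parts are still
    light, so discarding them costs at most (k + 1) / T of the rectangle.  Over d
    rounds this costs d (k + 1) / T, a leaf then costs at most 1 / T, and the at
    most 2^d rectangles of density below 2^-3d cost 2^-2d <= e^-d.  Finally
    k <= d < 2^(c2 Delta), as the bound exceeds 1 otherwise, so T of order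
    2^(2 c2 Delta) suffices. *)

(** * Overlap counting for families of sets *)

Section HeavySets.
Variables (I U : finType) (F : I -> {set U}).

Lemma sum_card_setI (X : {set U}) (J : {set I}) :
  \sum_(i in J) #|X :&: F i| = \sum_(x in X) #|[set i in J | x \in F i]|.
Proof.
have cardI i : #|X :&: F i| = \sum_(x in X | x \in F i) 1.
  by rewrite -sum1_card; apply: eq_bigl => x; rewrite inE.
under eq_bigr => i _ do rewrite cardI big_mkcondr.
rewrite exchange_big /=; apply: eq_bigr => x _.
by rewrite -big_mkcondr -sum1_card; apply: eq_bigl => i; rewrite inE.
Qed.

(** Both sides count pairs of a point [x] of [X] and a [k]-subset [S] of [J] all of whose sets
    contain [x]. *)
Lemma sum_binomial_card (X : {set U}) (J : {set I}) k :
  \sum_(x in X) 'C(#|[set i in J | x \in F i]|, k) =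
  \sum_(S : {set I} | (S \subset J) && (#|S| == k))
     #|X :&: \bigcap_(i in S) F i|.
Proof.
under eq_bigr => x _ do rewrite -cards_draws -sum1_card big_mkcond.
rewrite exchange_big [RHS]big_mkcond /=; apply: eq_bigr => S _.
rewrite -big_mkcondr; case: ifP => [/andP[SJ /eqP Sk]|nS].
  rewrite -sum1_card; apply: eq_bigl => x; rewrite !inE Sk eqxx andbT.
  case: (x \in X) => //=; apply/subsetP/bigcapP => [h i /h|h i iS].
    by rewrite inE => /andP[].
  by rewrite inE (subsetP SJ) // h.
rewrite big1 // => x /andP[_]; rewrite !inE => /andP[SJ Sk].
case/negP: (negbT nS); rewrite Sk andbT; apply: subset_trans SJ _.
by apply/subsetP => i; rewrite inE => /andP[].
Qed.

Lemma leq_binomial_expn n k : 'C(n, k) <= n ^ k.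
Proof.
rewrite (leq_trans (leq_pmulr _ (fact_gt0 k))) // bin_ffact.
by elim: k => // k IH; rewrite ffactnSr expnSr leq_mul ?leq_subr.
Qed.

Lemma leq_add_mul_binomial w s k : w <= s -> w <= k + s * 'C(w, k).
Proof.
move=> ws; case: (leqP w k) => [wk|/ltnW kw]; first exact: leq_trans wk (leq_addr _ _).
by rewrite (leq_trans ws) // (leq_trans _ (leq_addl _ _)) // leq_pmulr // bin_gt0.
Qed.

(** Points in at most [k] of the sets contribute at most [k * #|X|]. Any other point lies in some
    [k]-fold intersection and contributes at most [s]; there are at most [s ^ k] such intersections,
    each of size at most [#|X| / s ^ k.+1]. *)
Lemma sum_card_le_few (X : {set U}) (J : {set I}) k s :
  0 < s -> #|J| <= s ->
  (forall S : {set I}, #|S| = k -> s ^ k.+1 * #|\bigcap_(i in S) F i| <= #|X|) ->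
  \sum_(i in J) #|X :&: F i| <= k.+1 * #|X|.
Proof.
move=> s0 Js capF; rewrite sum_card_setI.
have -> : k.+1 * #|X| = \sum_(x in X) k + #|X| by rewrite sum_nat_const; lia.
apply: (@leq_trans (\sum_(x in X) (k + s * 'C(#|[set i in J | x \in F i]|, k)))).
  apply: leq_sum => x _; apply: leq_add_mul_binomial; apply: leq_trans Js.
  by apply: subset_leq_card; apply/subsetP => i; rewrite inE => /andP[].
rewrite big_split leq_add2l /= -big_distrr /= sum_binomial_card.
rewrite -(@leq_pmul2l (s ^ k)) ?expn_gt0 ?s0 // mulnA -expnSr big_distrr /=.
apply: (@leq_trans (\sum_(S : {set I} | (S \subset J) && (#|S| == k)) #|X|)).
  apply: leq_sum => S /andP[_ /eqP Sk]; apply: leq_trans (capF S Sk).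
  by rewrite leq_mul2l subset_leq_card ?subsetIr ?orbT.
rewrite sum_nat_const leq_mul2r; apply/orP; right.
apply: (@leq_trans 'C(#|J|, k)).
  by rewrite -cards_draws; apply/eq_leq/eq_card => S; rewrite !inE.
by rewrite (leq_trans (leq_binomial_expn _ _)) //; case: k {capF} => // k; rewrite leq_exp2r.
Qed.

Lemma sum_card_le_heavy (X : {set U}) (J : {set I}) k T :
  0 < T ->
  (forall S : {set I}, #|S| = k ->
     (k.+1 * T) ^ k.+1 * #|\bigcap_(i in S) F i| <= #|X|) ->
  (forall i, i \in J -> #|X| < T * #|X :&: F i|) ->
  \sum_(i in J) #|X :&: F i| <= k.+1 * #|X|.
Proof.
move=> T0 capF heavy; have s0 : 0 < k.+1 * T by rewrite muln_gt0.
(* A larger J would contain a heavy K of size exactly k.+1 * T, contradicting sum_card_le_few. *)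
case: (leqP #|J| (k.+1 * T)) => [Js|sJ]; first exact: sum_card_le_few capF.
have [K KJ Ks] : exists2 K : {set I}, K \subset J & #|K| = k.+1 * T.
  have /card_gt0P[K] : 0 < #|[set K : {set I} | K \subset J & #|K| == k.+1 * T]|.
    by rewrite cards_draws bin_gt0 ltnW.
  by rewrite inE => /andP[? /eqP]; exists K.
have := sum_card_le_few s0 (eq_leq Ks) capF.
(* One index [i0] carries the strict inequality; the other terms are compared weakly. *)
have [i0 i0K] : exists i, i \in K by apply/card_gt0P; rewrite Ks.
rewrite -(leq_pmul2l T0) big_distrr /= leqNgt => /negP[].
have -> : T * (k.+1 * #|X|) = \sum_(i in K) #|X| by rewrite sum_nat_const Ks; lia.
rewrite !(bigD1 i0 i0K) /= -addSn leq_add ?heavy ?(subsetP KJ) //.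
by apply: leq_sum => i /andP[iK _]; rewrite ltnW // heavy // (subsetP KJ).
Qed.
End HeavySets.

(** * Induction on the protocol over rectangles *)

Section Rectangles.
Variables (n m : nat) (F G : 'I_m -> {set bits n}).
Implicit Types (X Y : {set bits n}) (D J : {set 'I_m}) (P : protocol n m).

(** [F i] and [G i] stand for the inputs falsifying the x-part and the y-part of clause [i]; answers
    in [D] are charged separately. *)
Definition failures P X Y D : {set bits n * bits n} :=
  [set p | [&& p.1 \in X, p.2 \in Y, prot_eval P p.1 p.2 \notin D,
              p.1 \in F (prot_eval P p.1 p.2) & p.2 \in G (prot_eval P p.1 p.2)]].

Lemma card_failures_le P X Y D : #|failures P X Y D| <= #|X| * #|Y|.
Proof.
rewrite -cardsX; apply: subset_leq_card; apply/subsetP => p.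
by rewrite !inE => /and3P[-> -> _].
Qed.

Lemma card_failures_leaf i X Y D :
  #|failures (PLeaf n i) X Y D| <= (i \notin D) * (#|X :&: F i| * #|Y :&: G i|).
Proof.
rewrite -cardsX; case: (boolP (i \in D)) => iD.
  rewrite leqn0 cards_eq0; apply/eqP/setP => p; rewrite !inE /= iD /=.
  by rewrite !andbF.
rewrite mul1n; apply: subset_leq_card; apply/subsetP => p.
by rewrite !inE /= => /and5P[-> -> _ -> ->].
Qed.

(** A failure lost by discarding [J] has its answer [i] in [J], so it lies in the product of
    [X :&: F i] and [Y :&: G i]. *)
Lemma card_failures_kill P X Y D J :
  #|failures P X Y D| <=
    #|failures P X Y (D :|: J)| + \sum_(i in J) #|X :&: F i| * #|Y :&: G i|.
Proof.
set B := \bigcup_(i in J) setX (X :&: F i) (Y :&: G i).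
have cardB : #|B| <= \sum_(i in J) #|X :&: F i| * #|Y :&: G i|.
  rewrite /B; elim/big_rec2: _ => [|i a b _ ab]; first by rewrite cards0.
  by rewrite (leq_trans (leq_card_setU _ _)) // cardsX leq_add2l.
apply: leq_trans (leq_add (leqnn _) cardB).
apply: leq_trans (leq_card_setU _ _); apply: subset_leq_card; apply/subsetP => p.
rewrite !inE => /and5P[pX pY pD pF pG]; rewrite pX pY (negbTE pD) pF pG /= andbT.
case: (boolP (_ \in J)) => //= pJ; apply/bigcupP; exists (prot_eval P p.1 p.2) => //.
by rewrite !inE pX pY pF pG.
Qed.

Lemma card_failures_Alice f P0 P1 X Y D :
  #|failures (PAlice f P0 P1) X Y D| <=
    #|failures P0 (X :\: [set x | f x]) Y D| + #|failures P1 (X :&: [set x | f x]) Y D|.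
Proof.
apply: leq_trans (leq_card_setU _ _); apply: subset_leq_card; apply/subsetP => p.
by rewrite !inE /=; case: (f p.1) => /and5P[-> -> -> -> ->]; rewrite ?orbT.
Qed.

Lemma card_failures_Bob g P0 P1 X Y D :
  #|failures (PBob g P0 P1) X Y D| <=
    #|failures P0 X (Y :\: [set y | g y]) D| + #|failures P1 X (Y :&: [set y | g y]) D|.
Proof.
apply: leq_trans (leq_card_setU _ _); apply: subset_leq_card; apply/subsetP => p.
by rewrite !inE /=; case: (g p.2) => /and5P[-> -> -> -> ->]; rewrite ?orbT.
Qed.

Variables (k T e : nat).
Hypothesis T0 : 0 < T.

Definition light_family (H : 'I_m -> {set bits n}) X D :=
  forall i, i \notin D -> T * #|X :&: H i| <= #|X|.

(** The only consequence of expansion that the induction on the protocol uses. *)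
Definition heavy_sums_bounded (H : 'I_m -> {set bits n}) :=
  forall X J, #|{: bits n}| <= 2 ^ e * #|X| ->
    (forall i, i \in J -> #|X| < T * #|X :&: H i|) ->
    \sum_(i in J) #|X :&: H i| <= k.+1 * #|X|.

(* The last summand pays for the rectangles of density below 2^-e, one per leaf. *)
Definition failure_bound P :=
  forall X Y D, light_family F X D -> light_family G Y D ->
  T * 2 ^ e * #|failures P X Y D| <=
    2 ^ e * (1 + prot_depth P * k.+1) * (#|X| * #|Y|)
    + T * 2 ^ prot_depth P * #|{: bits n}| ^ 2.

(** [D] is removed from the killed set because only clauses outside [D] are known to be light on the
    other side. *)
Lemma light_family_kill (H : 'I_m -> {set bits n}) X D :
  light_family H X (D :|: ([set i | #|X| < T * #|X :&: H i|] :\: D)).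
Proof. by move=> i; rewrite !inE; case: (i \in D) => //=; rewrite -leqNgt. Qed.

Lemma light_family_setU (H : 'I_m -> {set bits n}) X D J :
  light_family H X D -> light_family H X (D :|: J).
Proof. by move=> lX i; rewrite inE negb_or => /andP[/lX]. Qed.

(** In a dense rectangle, killing [J] costs one more [k.+1] term before the bound for [P] applies. A
    sparse rectangle is paid for whole by the last summand, so the bound on [J] is required only in
    the dense case. *)
Lemma failure_bound_step P X Y D J :
  failure_bound P ->
  light_family F X (D :|: J) -> light_family G Y (D :|: J) ->
  (#|{: bits n}| ^ 2 <= 2 ^ e * (#|X| * #|Y|) ->
     T * (\sum_(i in J) #|X :&: F i| * #|Y :&: G i|) <= k.+1 * (#|X| * #|Y|)) ->
  T * 2 ^ e * #|failures P X Y D| <=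
    2 ^ e * (1 + (prot_depth P).+1 * k.+1) * (#|X| * #|Y|)
    + T * 2 ^ prot_depth P * #|{: bits n}| ^ 2.
Proof.
move=> IH lX lY sumJ; case: (leqP (#|{: bits n}| ^ 2) (2 ^ e * (#|X| * #|Y|))) => [/sumJ|/ltnW].
  have := IH _ _ _ lX lY; have := card_failures_kill P X Y D J.
  move: (\sum_(i in J) _) #|failures _ _ _ _| #|failures _ _ _ _| => S b a ab IHb TS.
  apply: (@leq_trans (T * 2 ^ e * b + 2 ^ e * (T * S))).
    by rewrite mulnCA mulnA -mulnDr leq_mul2l ab orbT.
  have : 2 ^ e * (T * S) <= 2 ^ e * (k.+1 * (#|X| * #|Y|)) by rewrite leq_mul2l TS orbT.
  move: IHb; set p := prot_depth P; rewrite mulSn; nia.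
move=> small; apply: leq_trans (leq_addl _ _).
rewrite -!mulnA leq_mul2l; apply/orP; right.
apply: (@leq_trans (2 ^ e * (#|X| * #|Y|))); first by rewrite leq_mul2l card_failures_le orbT.
by rewrite (leq_trans small) // leq_pmull // expn_gt0.
Qed.

Lemma failure_bound_add a b p d0 d1 x0 x1 N :
  a + b >= p ->
  T * 2 ^ e * a <= 2 ^ e * (1 + d0.+1 * k.+1) * x0 + T * 2 ^ d0 * N ->
  T * 2 ^ e * b <= 2 ^ e * (1 + d1.+1 * k.+1) * x1 + T * 2 ^ d1 * N ->
  T * 2 ^ e * p <=
    2 ^ e * (1 + (maxn d0 d1).+1 * k.+1) * (x0 + x1) + T * 2 ^ (maxn d0 d1).+1 * N.
Proof.
move=> pab ha hb; set M := maxn d0 d1.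
apply: (@leq_trans (T * 2 ^ e * (a + b))); first by rewrite leq_mul2l pab orbT.
have mono d x c : d <= M ->
    T * 2 ^ e * c <= 2 ^ e * (1 + d.+1 * k.+1) * x + T * 2 ^ d * N ->
    T * 2 ^ e * c <= 2 ^ e * (1 + M.+1 * k.+1) * x + T * 2 ^ M * N.
  move=> dM /leq_trans; apply; rewrite leq_add // leq_mul // leq_mul //.
    by rewrite leq_add2l leq_mul2r ltnS dM orbT.
  by rewrite leq_exp2l.
have {}ha := mono _ _ _ (leq_maxl _ _) ha; have {}hb := mono _ _ _ (leq_maxr _ _) hb.
rewrite mulnDr (leq_trans (leq_add ha hb)) // expnS; nia.
Qed.

Lemma card_big_rectangle X Y :
  #|{: bits n}| ^ 2 <= 2 ^ e * (#|X| * #|Y|) ->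
  (#|{: bits n}| <= 2 ^ e * #|X|) && (#|{: bits n}| <= 2 ^ e * #|Y|).
Proof.
have N0 : 0 < #|{: bits n}| by apply/card_gt0P; exists [ffun=> true].
have hX := max_card X; have hY := max_card Y.
rewrite -mulnn => h; apply/andP; split; rewrite -(leq_pmul2l N0).
  by rewrite (leq_trans h) // mulnA mulnC leq_mul2r hY orbT.
by rewrite (leq_trans h) // mulnCA leq_mul2r hX orbT.
Qed.

Lemma protocol_failure_bound P :
  heavy_sums_bounded F -> heavy_sums_bounded G -> failure_bound P.
Proof.
move=> sF sG; elim: P => [i|f P0 IH0 P1 IH1|g P0 IH0 P1 IH1] X Y D lX lY /=.
- apply: leq_trans (leq_addr _ _).
  rewrite mul0n addn0 muln1 [T * _]mulnC -mulnA leq_mul2l.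
  apply/orP; right; apply: leq_trans (leq_mul (leqnn T) (card_failures_leaf _ _ _ _)) _.
  case: (boolP (i \in D)) => iD; first by rewrite mul0n muln0.
  rewrite mul1n mulnA leq_mul //; first exact: lX.
  by rewrite subset_leq_card // subsetIl.
- have step P' X' : failure_bound P' ->
    T * 2 ^ e * #|failures P' X' Y D| <=
      2 ^ e * (1 + (prot_depth P').+1 * k.+1) * (#|X'| * #|Y|)
      + T * 2 ^ prot_depth P' * #|{: bits n}| ^ 2.
    move=> IH; apply: failure_bound_step IH (light_family_kill (H := F) (D := D)) _ _.
      exact: light_family_setU.
    move=> /card_big_rectangle/andP[bigX _].
    apply: (@leq_trans (\sum_(i in [set i | #|X'| < T * #|X' :&: F i|] :\: D)
                          #|X' :&: F i| * #|Y|)).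
      rewrite big_distrr /=; apply: leq_sum => i /setDP[_ iD].
      by rewrite mulnCA leq_mul2l lY ?orbT.
    rewrite -big_distrl /= mulnA leq_mul2r sF ?orbT // => i.
    by rewrite !inE => /andP[].
  (* The two children partition the rectangle, so the main term does not double; only the sparse
     term does. *)
  have -> : #|X| * #|Y| =
      #|X :\: [set x | f x]| * #|Y| + #|X :&: [set x | f x]| * #|Y|.
    by rewrite -mulnDl addnC cardsID.
  by apply: failure_bound_add (card_failures_Alice _ _ _ _ _ _) _ _; apply: step.
- have step P' Y' : failure_bound P' ->
    T * 2 ^ e * #|failures P' X Y' D| <=
      2 ^ e * (1 + (prot_depth P').+1 * k.+1) * (#|X| * #|Y'|)
      + T * 2 ^ prot_depth P' * #|{: bits n}| ^ 2.
    move=> IH; apply: failure_bound_step IH _ (light_family_kill (H := G) (D := D)) _.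
      exact: light_family_setU.
    move=> /card_big_rectangle/andP[_ bigY].
    apply: (@leq_trans (\sum_(i in [set i | #|Y'| < T * #|Y' :&: G i|] :\: D)
                          #|X| * #|Y' :&: G i|)).
      rewrite big_distrr /=; apply: leq_sum => i /setDP[_ iD].
      by rewrite mulnA leq_mul2r lX ?orbT.
    rewrite -big_distrr /= mulnCA leq_mul2l sG ?orbT // => i.
    by rewrite !inE => /andP[].
  have -> : #|X| * #|Y| =
      #|X| * #|Y :\: [set y | g y]| + #|X| * #|Y :&: [set y | g y]|.
    by rewrite -mulnDr addnC cardsID.
  by apply: failure_bound_add (card_failures_Bob _ _ _ _ _ _) _ _; apply: step.
Qed.
End Rectangles.

(** * Falsified clauses and expansion *)

Section FalsifiedClauses.
Variables (m n : nat) (E : {set 'I_m * 'I_n}) (s : 'I_m -> 'I_n -> bool).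

Definition falsified (i : 'I_m) : {set bits n} :=
  [set x : bits n | ~~ [exists j in nbhd E [set i], x j == s i j]].

(** Falsifying every clause of [S] forces every variable in [nbhd E S]. Clauses with conflicting
    signs only make the intersection empty. *)
Lemma card_bigcap_falsified (S : {set 'I_m}) :
  #|\bigcap_(i in S) falsified i| * 2 ^ #|nbhd E S| <= 2 ^ n.
Proof.
(* [g j] is the value forced by one chosen clause; the default [true] is never consulted, as [A j]
   uses [g] only on [nbhd E S]. *)
pose g j := if [pick i | (i \in S) && ((i, j) \in E)] is Some i then ~~ s i j else true.
pose A j : pred bool := if j \in nbhd E S then pred1 (g j) else predT.
have sub : #|\bigcap_(i in S) falsified i| <= #|finfun.family A|.
  apply: subset_leq_card; apply/subsetP => x /bigcapP xF; apply/familyP => j.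
  rewrite /A; case: ifP => //; rewrite inE => /existsP[i0 /andP[i0S i0E]].
  rewrite inE /g; case: pickP => [i /andP[iS iE]|/(_ i0)]; last by rewrite i0S i0E.
  have := xF i iS; rewrite inE negb_exists => /forallP/(_ j).
  rewrite negb_and inE => /orP[/existsP[]|].
    by exists i; rewrite inE eqxx.
  by case: (x j); case: (s i j).
apply: leq_trans (leq_mul sub (leqnn _)) _.
have -> : 2 ^ n = \prod_(j : 'I_n) 2 by rewrite prod_nat_const card_ord.
have -> : 2 ^ #|nbhd E S| = \prod_(j in nbhd E S) 2 by rewrite prod_nat_const.
rewrite card_family foldrE big_map big_enum /= [X in _ * X]big_mkcond -big_split /=.
apply: leq_prod => j _; rewrite /A; case: ifP => _.
  by rewrite card1.
by rewrite (eq_card (B := {: bool})) // card_bool.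
Qed.

Lemma heavy_sums_bounded_falsified k T e :
  0 < T ->
  (forall S : {set 'I_m}, #|S| = k -> (k.+1 * T) ^ k.+1 * 2 ^ e <= 2 ^ #|nbhd E S|) ->
  heavy_sums_bounded k T e falsified.
Proof.
move=> T0 expand X J bigX heavy; apply: sum_card_le_heavy T0 _ heavy => S Sk.
have := card_bigcap_falsified S; have := expand S Sk.
have := bigX; rewrite card_ffun card_bool card_ord => {}bigX.
move: (_ ^ k.+1) #|\bigcap_(i in S) _| => c b cN bN.
rewrite -(@leq_pmul2l (2 ^ e)) ?expn_gt0 //.
apply: leq_trans bigX; apply: leq_trans bN.
by rewrite mulnA [2 ^ e * c]mulnC mulnC leq_mul2l cN orbT.
Qed.

(** At the root of the protocol, wide clauses are light on the full cube and nothing is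
    discarded. *)
Lemma light_family_falsified t :
  (forall i, t <= #|nbhd E [set i]|) -> light_family (2 ^ t) falsified setT set0.
Proof.
move=> deg i _; rewrite setTI cardsT card_ffun card_bool card_ord.
apply: leq_trans (card_bigcap_falsified [set i]).
by rewrite big_set1 mulnC leq_mul2l leq_exp2l // deg orbT.
Qed.
End FalsifiedClauses.

(** * Counting bound with explicit parameters *)

Lemma card_clause_failures (m n : nat) (E1 E2 : {set 'I_m * 'I_n}) s1 s2
    (P : protocol n m) k w :
  0 < k <= prot_depth P -> prot_depth P <= 2 ^ w ->
  (forall S : {set 'I_m}, #|S| = k ->
     (6 * w + 6) * k + 3 * prot_depth P <= minn #|nbhd E1 S| #|nbhd E2 S|) ->
  (forall i, 2 * w + 2 <= minn #|nbhd E1 [set i]| #|nbhd E2 [set i]|) ->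
  2 ^ w * 2 ^ (2 * prot_depth P) *
    #|[set xy : bits n * bits n |
         ~~ clause_val E1 E2 s1 s2 (prot_eval P xy.1 xy.2) xy.1 xy.2]| <=
  (prot_depth P * 2 ^ (2 * prot_depth P) + 2 ^ w) * #|{: bits n * bits n}|.
Proof.
(* Since [k <= d <= 2 ^ w], this [T] makes [(1 + d * k.+1) / T] at most [d / 2 ^ w]. *)
set d := prot_depth P; set T := 2 ^ (2 * w + 2) => /andP[k0 kd] dw expand deg.
have T0 : 0 < T by rewrite expn_gt0.
(* Here [k.+1 * T <= 2 ^ (3 * w + 3)], and [k.+1 <= 2 * k] gives the exponent [(6 * w + 6) * k]. *)
have capacity (N : {set 'I_m} -> {set 'I_n}) (S : {set 'I_m}) :
    (6 * w + 6) * k + 3 * d <= #|N S| -> (k.+1 * T) ^ k.+1 * 2 ^ (3 * d) <= 2 ^ #|N S|.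
  move=> h; apply: leq_trans (_ : 2 ^ ((6 * w + 6) * k + 3 * d) <= _); last first.
    by rewrite leq_exp2l.
  rewrite expnD leq_mul2r; apply/orP; right.
  have k1 : k.+1 <= 2 ^ w.+1 by rewrite expnS; lia.
  apply: leq_trans (_ : (2 ^ (3 * w + 3)) ^ k.+1 <= _).
    rewrite leq_exp2r // (_ : 3 * w + 3 = w.+1 + (2 * w + 2)); last by lia.
    by rewrite [2 ^ _]expnD leq_mul2r k1 orbT.
  by rewrite -expnM leq_exp2l //; nia.
have heavy1 : heavy_sums_bounded k T (3 * d) (falsified E1 s1).
  apply: heavy_sums_bounded_falsified T0 _ => S Sk; apply: capacity.
  by have := expand S Sk; rewrite leq_min => /andP[].
have heavy2 : heavy_sums_bounded k T (3 * d) (falsified E2 s2).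
  apply: heavy_sums_bounded_falsified T0 _ => S Sk; apply: capacity.
  by have := expand S Sk; rewrite leq_min => /andP[].
have light1 : light_family T (falsified E1 s1) setT set0.
  by apply: light_family_falsified => i; have := deg i; rewrite leq_min => /andP[].
have light2 : light_family T (falsified E2 s2) setT set0.
  by apply: light_family_falsified => i; have := deg i; rewrite leq_min => /andP[].
have := protocol_failure_bound T0 P heavy1 heavy2 light1 light2.
have -> : failures (falsified E1 s1) (falsified E2 s2) P setT setT set0 =
    [set xy : bits n * bits n |
       ~~ clause_val E1 E2 s1 s2 (prot_eval P xy.1 xy.2) xy.1 xy.2].
  by apply/setP => p; rewrite !inE negb_or.
rewrite cardsT card_prod mulnn -/d.
move: #|[set _ | _]| (#|_| ^ 2) => b N bound.
have TE : T = 4 * 2 ^ w * 2 ^ w by rewrite /T addnC mul2n -addnn !expnD mulnA.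
have e3 : 2 ^ (3 * d) = 2 ^ (2 * d) * 2 ^ d by rewrite -expnD; congr (2 ^ _); lia.
have small : 1 + d * k.+1 <= 4 * 2 ^ w * d by nia.
(* This factor turns [2 ^ w * 2 ^ (2 * d)] into [T * 2 ^ (3 * d)]. *)
rewrite -(@leq_pmul2l (4 * 2 ^ w * 2 ^ d)) ?muln_gt0 ?expn_gt0 //.
apply: leq_trans (leq_trans bound _); first by rewrite TE e3; nia.
apply: (@leq_trans (2 ^ (3 * d) * (4 * 2 ^ w * d) * N + T * 2 ^ d * N)).
  by rewrite leq_add2r leq_mul2r leq_mul2l small !orbT.
by rewrite TE e3; nia.
Qed.

(** * Real-number estimates *)

Lemma INR_addn a b : INR (a + b) = (INR a + INR b)%R.
Proof. by rewrite -plusE plus_INR. Qed.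

Lemma INR_muln a b : INR (a * b) = (INR a * INR b)%R.
Proof. by rewrite -multE mult_INR. Qed.

Lemma INR_exp2n a : INR (2 ^ a) = (2 ^ a)%R.
Proof. by elim: a => //= a IH; rewrite expnS INR_muln IH. Qed.

Lemma leq_INR a b : a <= b -> (INR a <= INR b)%R.
Proof. by move/leP; exact: le_INR. Qed.

Lemma INR_leq a b : (INR a <= INR b)%R -> a <= b.
Proof. by move=> h; apply/leP/INR_le. Qed.

Lemma nat_ceil (u : R) : (0 <= u)%R -> exists w : nat, (u <= INR w <= u + 1)%R.
Proof.
move=> u0; have [up1 up2] := archimed u.
have up0 : (0 <= up u)%Z by apply: le_IZR; lra.
exists (Z.to_nat (up u)); rewrite INR_IZR_INZ Z2Nat.id //; lra.
Qed.

(** Amounts to [e <= 4], raised to the power [d]. *)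
Lemma inv_exp2_le_exp_opp d : (/ 2 ^ (2 * d) <= exp (- INR d))%R.
Proof.
rewrite exp_Ropp; apply: Rinv_le_contravar; first exact: exp_pos.
rewrite -multE pow_mult; elim: d => [|d IH]; first by rewrite exp_0 /=; lra.
rewrite S_INR exp_plus Rmult_comm; apply: Rmult_le_compat => //; try exact/Rlt_le/exp_pos.
by have := exp_le_3; lra.
Qed.

Lemma inv_exp2_le_Rpower (u : R) w : (u <= INR w)%R -> (/ 2 ^ w <= Rpower 2 (- u))%R.
Proof.
move=> uw; rewrite -Rpower_pow; last by lra.
by rewrite -Rpower_Ropp; apply: Rle_Rpower; lra.
Qed.

Lemma one_sub_le_Rpower (u : R) : (0 <= u -> 1 - u <= Rpower 2 (- u))%R.
Proof.
move=> u0; have ln2 : (ln 2 <= 1)%R.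
  by rewrite -(ln_exp 1); apply/Rlt_le/ln_increasing; [lra|have := @exp_ineq1 1; lra].
have := exp_ineq1_le (- u * ln 2); rewrite /Rpower; nra.
Qed.

Lemma fail_prob_le1 (m n : nat) (E1 E2 : {set 'I_m * 'I_n}) s1 s2 (P : protocol n m) :
  (fail_prob E1 E2 s1 s2 P <= 1)%R.
Proof.
have N0 : (0 < INR #|{: bits n * bits n}|)%R.
  by apply/lt_0_INR/ltP/card_gt0P; exists ([ffun=> true], [ffun=> true]).
rewrite /fail_prob; apply: (Rmult_le_reg_r _ _ _ N0).
rewrite /Rdiv Rmult_assoc Rinv_l ?Rmult_1_r ?Rmult_1_l; last by lra.
exact/leq_INR/max_card.
Qed.

(** Here [2 ^ (- u) >= 2 / 3]: for [d = 1] add [1 / e >= 1 / 3], and for [d >= 2] the first term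
    already exceeds 1. *)
Lemma one_le_bound_small (d : nat) (u : R) :
  0 < d -> (0 <= u <= 1 / 3)%R ->
  (1 <= INR d * Rpower 2 (- u) + exp (- INR d))%R.
Proof.
case: d => // -[|d] _ [u0 u1]; have := one_sub_le_Rpower u0; move: (Rpower _ _) => p hp.
  have : (/ 3 <= exp (- INR 1))%R.
    rewrite exp_Ropp; apply: Rinv_le_contravar; [exact: exp_pos|exact: exp_le_3].
  rewrite /=; lra.
have := exp_pos (- INR d.+2); have := pos_INR d; rewrite !S_INR; nra.
Qed.

Lemma fail_prob_bound (m n : nat) (E1 E2 : {set 'I_m * 'I_n}) s1 s2
    (P : protocol n m) k w :
  0 < k <= prot_depth P -> prot_depth P <= 2 ^ w ->
  (forall S : {set 'I_m}, #|S| = k ->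
     (6 * w + 6) * k + 3 * prot_depth P <= minn #|nbhd E1 S| #|nbhd E2 S|) ->
  (forall i, 2 * w + 2 <= minn #|nbhd E1 [set i]| #|nbhd E2 [set i]|) ->
  (fail_prob E1 E2 s1 s2 P <=
     INR (prot_depth P) * / 2 ^ w + / 2 ^ (2 * prot_depth P))%R.
Proof.
move=> kd dw expand deg.
have N0 : (0 < INR #|{: bits n * bits n}|)%R.
  by apply/lt_0_INR/ltP/card_gt0P; exists ([ffun=> true], [ffun=> true]).
have := leq_INR (card_clause_failures s1 s2 kd dw expand deg).
rewrite /fail_prob !(INR_muln, INR_addn, INR_exp2n).
have p1 : (0 < 2 ^ w)%R by apply: pow_lt; lra.
have p2 : (0 < 2 ^ (2 * prot_depth P))%R by apply: pow_lt; lra.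
move: (INR (prot_depth P)) (2 ^ w)%R (2 ^ (2 * prot_depth P))%R (INR #|{: _}|) N0 p1 p2 => d x y N N0 x0 y0.
move: (INR _) => b h.
apply: (Rmult_le_reg_r (x * y * N)); first by repeat apply: Rmult_lt_0_compat.
have -> : (b / N * (x * y * N) = x * y * b)%R by field; lra.
have -> : ((d * / x + / y) * (x * y * N) = (d * y + x) * N)%R by field; lra.
exact: h.
Qed.

(** * Choice of the constants and conclusion *)

Theorem mainTheorem3 :
  forall alpha : R, (0 < alpha)%R ->
  exists c1 c2 : R, (0 < c1)%R /\ (0 < c2)%R /\
  forall (m n r Delta : nat) (E1 E2 : {set 'I_m * 'I_n}),
    is_expander E1 r Delta alpha ->
    is_expander E2 r Delta alpha ->
    forall (s1 s2 : 'I_m -> 'I_n -> bool) (P : protocol n m),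
      (INR (prot_depth P) <= c1 * INR Delta * INR r)%R ->
      (fail_prob E1 E2 s1 s2 P <=
         INR (prot_depth P) * Rpower 2 (- (c2 * INR Delta)) + exp (- INR (prot_depth P)))%R.
Proof.
move=> alpha alpha0; exists (alpha / 24)%R, (alpha / 64)%R; split; first lra.
split=> [|m n r Delta E1 E2 [_ exp1] [_ exp2] s1 s2 P]; first lra.
have [P1 D0] := (fail_prob_le1 E1 E2 s1 s2 P, pos_INR Delta).
set u := (alpha / 64 * INR Delta)%R; have u0 : (0 <= u)%R by apply: Rmult_le_pos; lra.
have aDelta : (alpha * INR Delta = 64 * u)%R by rewrite /u; field.
have -> : (alpha / 24 * INR Delta * INR r = 64 / 24 * u * INR r)%R by rewrite /u; field.
rewrite {}aDelta in exp1 exp2.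
set d := prot_depth P => dr.
have e0 := exp_pos (- INR d).
case: (posnP d) => [->|d0].
  by rewrite Ropp_0 exp_0 Rmult_0_l Rplus_0_l.
case: (Rle_lt_dec u (1 / 3)) => [u3|u3].
  exact: Rle_trans P1 (one_le_bound_small d0 (conj u0 u3)).
(* If this product reaches 1 the claim is trivial; otherwise [d < 2 ^ u <= 2 ^ w]. *)
case: (Rle_lt_dec 1 (INR d * Rpower 2 (- u))) => [?|dp]; first lra.
have [w [uw wu]] := nat_ceil u0.
have d1 : (1 <= INR d)%R by apply: (leq_INR d0).
have r0 : 0 < r by case: (posnP r) dr => // -> /=; lra.
have r1 : (1 <= INR r)%R by apply: (leq_INR r0).
have dw : d <= 2 ^ w.
  apply: INR_leq; rewrite INR_exp2n -Rpower_pow; last lra.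
  apply: Rle_trans (_ : Rpower 2 u <= _)%R; last by apply: Rle_Rpower; lra.
  have := exp_pos (- u * ln 2); rewrite -/(Rpower 2 (- u)) => pos.
  have pq : (Rpower 2 u * Rpower 2 (- u) = 1)%R.
    by rewrite -Rpower_plus Rplus_opp_r Rpower_O //; lra.
  by apply: (Rmult_le_reg_r _ _ _ pos); lra.
(* The choice k = d also works when d < r, since 64 u > 12. *)
pose k := minn r d.
have k0 : 0 < k by rewrite leq_min r0.
have kr : k <= r by exact: geq_minl.
have k12 : (12 * INR d <= 64 * u * INR k)%R.
  by rewrite /k /minn; case: ifP => _; nra.
have k1 : (1 <= INR k)%R by apply: (leq_INR k0).
(* With [w <= u + 1] and [u > 1 / 3], [6 * w + 6] is below [42 * u], while [k12] gives
   [3 * d <= 16 * u * k]; together they stay below [64 * u * k]. *)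
have sizeS (N : {set 'I_m} -> {set 'I_n}) (S : {set 'I_m}) :
    (forall S : {set 'I_m}, #|S| <= r -> (64 * u * INR #|S| <= INR #|N S|)%R) ->
    #|S| = k -> (6 * w + 6) * k + 3 * d <= #|N S|.
  move=> ex Sk; apply: INR_leq; have := ex S; rewrite Sk => /(_ kr).
  by rewrite !(INR_addn, INR_muln) /=; nra.
have sizei (N : {set 'I_m} -> {set 'I_n}) i :
    (forall S : {set 'I_m}, #|S| <= r -> (64 * u * INR #|S| <= INR #|N S|)%R) ->
    2 * w + 2 <= #|N [set i]|.
  move=> ex; apply: INR_leq; have := ex [set i]; rewrite cards1 => /(_ r0).
  by rewrite !(INR_addn, INR_muln) /=; lra.
apply: Rle_trans (@fail_prob_bound _ _ E1 E2 s1 s2 P k w _ dw _ _) _.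
- by rewrite k0 geq_minr.
- by move=> S Sk; rewrite leq_min !sizeS.
- by move=> i; rewrite leq_min !sizei.
apply: Rplus_le_compat (inv_exp2_le_exp_opp _).
exact: Rmult_le_compat_l (pos_INR _) (inv_exp2_le_Rpower uw).
Qed.
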